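(* Let $q\in\mathbb{C}$, let $\lambda/\mu$ be a skew shape, and set $n=|\lambda|-|\mu|$. The Hall-Littlewood $S$-symmetric function with parameter $t=-q$ has the following expansion in $q$-fundamental quasisymmetric functions: $$S_{\lambda/\mu}(X;-q)=\sum_{T\in\mathrm{SYT}(\lambda/\mu)}L^{(q)}_{n,\mathrm{Des}(T)}(X).$$
   Context: Notation. $X=\{x_1,x_2,x_3,\dots\}$ is a set of indeterminates, $\mathbb{P}=\{1,2,3,\dots\}$, $[n]=\{1,\dots,n\}$, and $\mathbb{P}^{\pm}$ is the set of all positive and negative integers, totally ordered by $-1<1<-2<2<-3<3<\cdots$; $-\mathbb{P}=\{-n: n\in\mathbb{P}\}\subseteq\mathbb{P}^\pm$. In expressions $[f(i)<0]$ below, ''$<0$'' means $f(i)\in-\mathbb{P}$; the bracket is $1$ if this holds and $0$ otherwise. Hall-Littlewood $S$-functions. For $t\in\mathbb{C}$ the symmetric functions $q_n(X;t)$ are defined by $\sum_{n\ge 0}q_n(X;t)u^n=\prod_i\frac{1-x_itu}{1-x_iu}$, so $q_0=1$, and $q_n(X;t)=0$ for $n<0$. A skew shape $\lambda/\mu$ is given by partitions $\lambda=(\lambda_1,\dots,\lambda_{\ell(\lambda)})$ and $\mu$ with $\ell(\mu)\le\ell(\lambda)$ and $\mu_i\le\lambda_i$ for all $i\le\ell(\mu)$ (put $\mu_i=0$ for $i>\ell(\mu)$); $|\lambda|=\sum_i\lambda_i$. Its diagram has, in row $i$ from the top, the boxes in columns $\mu_i+1,\dots,\lambda_i$. Set $$S_{\lambda/\mu}(X;t)=\det\left(q_{\lambda_i-\mu_j-i+j}(X;t)\right)_{1\le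 i,j\le\ell(\lambda)}.$$ Standard tableaux. $\mathrm{SYT}(\lambda/\mu)$ is the set of standard Young tableaux of shape $\lambda/\mu$: fillings of the diagram with $1,\dots,n$, each used once, increasing along rows (left to right) and down columns. $\mathrm{Des}(T)=\{1\le i\le n-1: i\text{ is in a strictly higher row of }T\text{ than }i+1\}$. $q$-fundamental quasisymmetric functions. For a labelled poset $P=([n],<_P)$ (an arbitrary partial order on $[n]$), an enriched $P$-partition is a map $f:[n]\to\mathbb{P}^\pm$ such that: (i) if $i<_Pj$ and $i<j$, then $f(i)<f(j)$ or $f(i)=f(j)\in\mathbb{P}$; (ii) if $i<_Pj$ and $i>j$, then $f(i)<f(j)$ or $f(i)=f(j)\in-\mathbb{P}$. Let $\mathcal{L}_{\mathbb{P}^\pm}(P)$ be the set of these maps and $\Gamma^{(q)}([n],<_P)=\sum_{f\in\mathcal{L}_{\mathbb{P}^\pm}(P)}\prod_{1\le i\le n}q^{[f(i)<0]}x_{|f(i)|}\in\mathbb{C}[[X]]$. For a permutation $\pi=\pi_1\cdots\pi_n$ of $[n]$, let $<_\pi$ be the total order on $[n]$ with $\pi_i<_\pi\pi_j$ if and only if $i<j$, and set $L^{(q)}_\pi=\Gamma^{(q)}([n],<_\pi)$. This depends only on $n$ and the descent set $\mathrm{Des}(\pi)=\{1\le i\le n-1:\pi_i>\pi_{i+1}\}$; for $I\subseteq[n-1]$ one writes $L^{(q)}_{n,I}=L^{(q)}_\pi$ for any permutation $\pi$ of $[n]$ with $\mathrm{Des}(\pi)=I$ (and $L^{(q)}_{0,\emptyset}=1$).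 *)

(* Defs.v *)
From HB Require Import structures.
From mathcomp Require Import all_boot all_order all_fingroup all_algebra.
From mathcomp Require Import finmap complex.
From mathcomp.multinomials Require Import monalg.
From mathcomp Require Import boolp classical_sets functions cardinality.
From mathcomp Require Import fsbigop filter reals.

Set Implicit Arguments.
Unset Strict Implicit.
Unset Printing Implicit Defensive.

Import Order.TTheory GRing.Theory.

Local Open Scope classical_set_scope.
Local Open Scope ring_scope.

Record powser (I : choiceType) (R : comNzRingType) : Type :=
  PowSer { coefps : {cmonom I} -> R }.

Section PowserRing.
Variables (I : choiceType) (R : comNzRingType).
Implicit Types (f g h : powser I R) (m : {cmonom I}).

HB.instance Definition _ := gen_eqMixin (powser I R).
HB.instance Definition _ := gen_choiceMixin (powser I R).

Lemma powserP f g : coefps f =1 coefps g -> f = g.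
Proof. by case: f g => [f] [g] /= /funext ->. Qed.

Let zerops : powser I R := PowSer (fun=> 0).
Let oppps f := PowSer (fun m => - coefps f m).
Let addps f g := PowSer (fun m => coefps f m + coefps g m).

Let addpsA : associative addps.
Proof. by move=> f g h; apply: powserP => m /=; rewrite addrA. Qed.
Let addpsC : commutative addps.
Proof. by move=> f g; apply: powserP => m /=; rewrite addrC. Qed.
Let add0ps : left_id zerops addps.
Proof. by move=> f; apply: powserP => m /=; rewrite add0r. Qed.
Let addNps : left_inverse zerops oppps addps.
Proof. by move=> f; apply: powserP => m /=; rewrite addNr. Qed.

HB.instance Definition _ :=
  GRing.isZmodule.Build (powser I R) addpsA addpsC add0ps addNps.

Definition splits m : set ({cmonom I} * {cmonom I}) :=
  [set p | mmul p.1 p.2 = m].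

Lemma finite_divisors m : finite_set [set a | exists b, mmul a b = m].
Proof.
set K := (\sum_(i <- finsupp m) m i)%N.
pose dec (v : {ffun finsupp m -> 'I_K.+1}) : {cmonom I} :=
  [cmonom (if insub i is Some j then val (v j) else 0) | i in finsupp m]%M.
apply: (@sub_finite_set _ _ (dec @` setT)); last first.
  by apply: finite_image; exact: finite_finset.
move=> a [b ab]; exists [ffun j : finsupp m => inord (a (val j))] => //.
apply/eqP/cmP => i; rewrite cmE fsfun_fun.
have le_am : (a i <= m i)%N by rewrite -ab cmM leq_addr.
case: ifPn => [mi|]; last first.
  by rewrite -cmE_eq0 => /eqP m0; move: le_am; rewrite m0 leqn0 => /eqP.
rewrite insubT /= ffunE /= inordK // ltnS.
by rewrite (leq_trans le_am)// /K (big_fsetD1 i mi) leq_addr.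
Qed.

Lemma finite_splits m : finite_set (splits m).
Proof.
have fin := finite_divisors m.
apply: sub_finite_set (finite_setX fin fin) => -[a b] /= ab.
by split=> /=; [exists b | exists a; rewrite mulmC].
Qed.

Let oneps : powser I R := PowSer (fun m => (m == mone)%:R).
Let mulps f g :=
  PowSer (fun m => \sum_(p \in splits m) coefps f p.1 * coefps g p.2).

Let splits_seq m : seq ({cmonom I} * {cmonom I}) := fset_set (splits m).

Let mem_splits m p : (p \in splits_seq m) = (mmul p.1 p.2 == m).
Proof.
rewrite in_fset_set; last exact: finite_splits.
by apply/idP/eqP; rewrite inE.
Qed.

Let mulpsE f g m :
  coefps (mulps f g) m = \sum_(p <- splits_seq m) coefps f p.1 * coefps g p.2.
Proof. by rewrite /= fsbig_finite //; exact: finite_splits. Qed.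

Let mulpsC : commutative mulps.
Proof.
move=> f g; apply: powserP => m; rewrite !mulpsE.
have swapK : involutive (fun p : {cmonom I} * {cmonom I} => (p.2, p.1)) by case.
have splitsC : perm_eq (splits_seq m) [seq (p.2, p.1) | p <- splits_seq m].
  apply: uniq_perm; rewrite ?map_inj_uniq ?fset_uniq //; first exact: inv_inj.
  by move=> p; rewrite -[p in RHS]swapK mem_map ?mem_splits 1?mulmC //;
    exact: inv_inj.
by rewrite (perm_big _ splitsC) big_map /=; apply: eq_bigr => p _; rewrite mulrC.
Qed.

Let mulpsA : associative mulps.
Proof.
move=> f g h; apply: powserP => m; rewrite !mulpsE.
pose T := ({cmonom I} * {cmonom I} * {cmonom I})%type.
pose F (x : T) := coefps f x.1.1 * coefps g x.1.2 * coefps h x.2.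
pose s1 : seq T := [seq ((p.1, q.1), q.2) | p <- splits_seq m, q <- splits_seq p.2].
pose s2 : seq T := [seq (q, p.2) | p <- splits_seq m, q <- splits_seq p.1].
have mem1 x : (x \in s1) = (mmul (mmul x.1.1 x.1.2) x.2 == m).
  apply/allpairsPdep/eqP => [[p [q [+ + ->]]]|xm].
    by rewrite !mem_splits => /eqP <- /eqP <- /=; rewrite mulmA.
  exists (x.1.1, mmul x.1.2 x.2), (x.1.2, x.2); rewrite !mem_splits /= mulmA xm.
  by split=> //; case: x {xm} => [[]].
have mem2 x : (x \in s2) = (mmul (mmul x.1.1 x.1.2) x.2 == m).
  apply/allpairsPdep/eqP => [[p [q [+ + ->]]]|xm].
    by rewrite !mem_splits => /eqP <- /eqP <- /=.
  exists (mmul x.1.1 x.1.2, x.2), x.1; rewrite !mem_splits /= xm.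
  by split=> //; case: x {xm} => [[]].
have uniq1 : uniq s1.
  apply: allpairs_uniq_dep => [|p _|]; rewrite ?fset_uniq//.
  move=> [p1 p2] [q1 q2] /allpairsPdep[a [b [_ + [-> ->]]]].
  move=> + /allpairsPdep[c [d [_ + [-> ->]]]]; rewrite !mem_splits /=.
  case: a b c d => [a1 a2] [b1 b2] [c1 c2] [d1 d2] /= /eqP <- /eqP <-.
  by case=> -> -> ->.
have uniq2 : uniq s2.
  apply: allpairs_uniq_dep => [|p _|]; rewrite ?fset_uniq//.
  move=> [p1 p2] [q1 q2] /allpairsPdep[a [b [_ + [-> ->]]]].
  move=> + /allpairsPdep[c [d [_ + [-> ->]]]]; rewrite !mem_splits /=.
  case: a b c d => [a1 a2] [b1 b2] [c1 c2] [d1 d2] /= /eqP <- /eqP <-.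
  by case=> -> -> ->.
transitivity (\sum_(x <- s1) F x).
  rewrite big_allpairs_dep; apply: eq_bigr => p _; rewrite mulpsE big_distrr /=.
  by apply: eq_bigr => q _; rewrite mulrA.
have s12 : perm_eq s1 s2.
  by apply: uniq_perm => // x; rewrite mem1 mem2.
rewrite (perm_big _ s12) big_allpairs_dep; apply: eq_bigr => p _; rewrite mulpsE big_distrl /=.
by apply: eq_bigr => q _.
Qed.

Let mul1ps : left_id oneps mulps.
Proof.
move=> f; apply: powserP => m; rewrite mulpsE.
rewrite (bigD1_seq (mone, m)) ?mem_splits ?fset_uniq //= ?mul1m //.
rewrite eqxx mul1r big_seq_cond big1 ?addr0 // => -[a b] /=.
rewrite mem_splits /= => /andP[/eqP <-]; rewrite xpair_eqE.
by case: eqP => [->|_]; rewrite ?mul1m ?eqxx // mul0r.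
Qed.

Let mulpsDl : left_distributive mulps addps.
Proof.
move=> f g h; apply: powserP => m.
transitivity (coefps (mulps f h) m + coefps (mulps g h) m); last by [].
rewrite !mulpsE -big_split /=.
by apply: eq_bigr => p _; rewrite mulrDl.
Qed.

Let oneps_neq0 : oneps != 0.
Proof.
by apply/eqP => /(congr1 (fun f => coefps f mone)) /= /eqP; rewrite eqxx oner_eq0.
Qed.

HB.instance Definition _ := GRing.Zmodule_isComNzRing.Build (powser I R)
  mulpsA mulpsC mul1ps mulpsDl oneps_neq0.

Let unitps : {pred powser I R} := fun f => `[< exists g, g * f = 1 >].
Let invps f := xget f [set g | g * f = 1].

Let mulVps : {in unitps, left_inverse 1 invps *%R}.
Proof.
by move=> f /asboolP[g gf]; rewrite /invps; case: xgetP => [_ -> //|/(_ g)].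
Qed.
Let unitpsP f g : g * f = 1 -> unitps f.
Proof. by move=> gf; apply/asboolP; exists g. Qed.
Let invps_out : {in [predC unitps], invps =1 id}.
Proof.
move=> f /asboolPn nuf; rewrite /invps; case: xgetP => // g _ gf.
by case: nuf; exists g.
Qed.

HB.instance Definition _ := GRing.ComNzRing_hasMulInverse.Build (powser I R)
  mulVps unitpsP invps_out.

Definition constps (c : R) : powser I R :=
  PowSer (fun m => if m == mone then c else 0).

Definition varps (i : I) : powser I R := PowSer (fun m => (m == ucm i)%:R).

(* Limit of a sequence for coefficientwise eventual stationarity. *)
Definition limps (F : nat -> powser I R) : powser I R :=
  PowSer (fun m => xget 0 [set c | \forall N \near \oo, coefps (F N) m = c]).

(* Sum of a family in which every monomial occurs in finitely many members. *)
Definition sumps (J : choiceType) (D : set J) (F : J -> powser I R) :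
  powser I R := PowSer (fun m => \sum_(j \in D) coefps (F j) m).

End PowserRing.

(* C[[X]]; the indeterminate of index k : nat is x_(k+1). *)
Definition serX (C : comNzRingType) : comUnitRingType := powser nat C.

Section HallLittlewood.
Variable C : comNzRingType.

(* C[[X]][[u]]; a monomial in the unit-indexed indeterminate is a power of u. *)
Definition hl_factor (t : C) (i : nat) : powser unit (serX C) :=
  let u := varps (serX C) tt in
  let x := varps C i in
  (1 - constps unit (x * constps nat t) * u) / (1 - constps unit x * u).

(* The coefficient of u^n in the infinite product of the factors above; the    *)
(* coefficients of its partial products in a given monomial are stationary.    *)
Definition hl_q (t : C) (n : nat) : serX C :=
  limps (fun N => coefps (\prod_(i < N) hl_factor t i) (expcmn (ucm tt) n)).

Definition hl_qz (t : C) (k : int) : serX C :=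
  if k is Posz n then hl_q t n else 0.

Definition hl_S (la mu : seq nat) (t : C) : serX C :=
  \det (\matrix_(i < size la, j < size la)
    hl_qz t ((nth 0 la i)%N%:Z - (nth 0 mu j)%N%:Z - i%:Z + j%:Z)).

End HallLittlewood.

Section QuasiSymmetric.
Variables (C : comNzRingType) (q : C) (n : nat).

(* The signed positive integers: (k, true) is k+1 and (k, false) is -(k+1), so *)
(* that the lexicographic order is -1 < 1 < -2 < 2 < ...                       *)
Definition spos : orderType _ := (nat *l bool)%type.
Definition isneg (z : spos) : bool := ~~ z.2.

(* [n] is represented by 'I_n, with a shift by one. *)
Definition enriched (ltP : rel 'I_n) (f : 'I_n -> spos) : Prop :=
  forall i j, ltP i j ->
    ((i < j)%N -> (f i < f j)%O \/ f i = f j /\ ~~ isneg (f i)) /\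
    ((j < i)%N -> (f i < f j)%O \/ f i = f j /\ isneg (f i)).

Definition Gammaq (ltP : rel 'I_n) : serX C :=
  sumps [set f : {ffun 'I_n -> spos} | enriched ltP f]
    (fun f => \prod_i (constps nat (q ^+ isneg (f i)) * varps C (f i).1)).

Definition perm_lt (pi : {perm 'I_n}) : rel 'I_n :=
  fun a b => ((pi^-1)%g a < (pi^-1)%g b)%N.

(* Subsets of [n-1] are represented in {set 'I_n.-1}, with a shift by one. *)
Definition perm_Des (pi : {perm 'I_n}) : {set 'I_n.-1} :=
  [set i : 'I_n.-1 | [exists a : 'I_n, exists b : 'I_n,
    [&& a == i :> nat, b == i.+1 :> nat & (pi b < pi a)%N]]].

Definition Lq_perm (pi : {perm 'I_n}) : serX C := Gammaq (perm_lt pi).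

(* Every I is the descent set of some permutation, and Lq_perm pi depends only *)
(* on perm_Des pi.                                                             *)
Definition Lq (I : {set 'I_n.-1}) : serX C :=
  if [pick pi | perm_Des pi == I] is Some pi then Lq_perm pi else 0.

End QuasiSymmetric.

Definition is_partition (la : seq nat) : bool :=
  sorted geq la && (0%N \notin la).

Definition is_skew_shape (la mu : seq nat) : bool :=
  [&& is_partition la, is_partition mu, (size mu <= size la)%N
    & [forall i : 'I_(size mu), (nth 0 mu i <= nth 0 la i)%N]].

Section Tableaux.
Variables (la mu : seq nat).

(* Rows and columns are numbered from 0. *)
Definition box : finType :=
  {b : 'I_(size la) * 'I_(head 0%N la) | (nth 0 mu b.1 <= b.2 < nth 0 la b.1)%N}.
Definition brow (b : box) : nat := (val b).1.
Definition bcol (b : box) : nat := (val b).2.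

Definition is_SYT (n : nat) (T : {ffun box -> 'I_n}) : bool :=
  [&& [forall v, #|[set b | T b == v]| == 1%N],
      [forall b, forall c, (brow b == brow c) && (bcol b < bcol c)%N
        ==> (T b < T c)%N]
    & [forall b, forall c, (bcol b == bcol c) && (brow b < brow c)%N
        ==> (T b < T c)%N]].

Definition SYT_Des (n : nat) (T : {ffun box -> 'I_n}) : {set 'I_n.-1} :=
  [set i : 'I_n.-1 | [exists b, exists c,
    [&& T b == i :> nat, T c == i.+1 :> nat & (brow b < brow c)%N]]].

End Tableaux.

(* Main.v *)
(* Split x_k into the signed letters -k < k, numbered c = 2k, 2k+1 from k = 0.  The
   coefficients H_c(m) of the product of the factors (1 + q x u) and 1/(1 - x u) over
   the letters below c satisfy H_{c+1}(m) = H_c(m) + w_c H_{c'}(m-1), with c' = c for a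
   negative letter and c' = c+1 for a positive one.  In the Jacobi-Trudi determinant,
   change the letter bound of one row at a time: for each letter, from the bottom row to
   the top one if it is positive, from top to bottom if it is negative.  Each change
   splits the determinant, by linearity in that row, into the previous one and w_c times
   the one whose row length is decreased by 1; if the shortened shape is not a
   partition, two rows of the latter determinant coincide.  Iterating, the determinant
   is the sum over all ways of growing mu into la one box at a time, the boxes carrying
   letters in an order that allows a repetition exactly when the letter is positive at a
   non-descent or negative at a descent: these are the pairs of a standard tableau T and
   a term of L_{n,Des(T)}.  Everything happens modulo the variables of index at least
   N, for N large with respect to the monomial under consideration. *)
Require Import Defs.
From mathcomp Require Import all_boot all_order all_fingroup all_algebra.
From mathcomp Require Import finmap zify.
From mathcomp.multinomials Require Import monalg.
From mathcomp Require Import boolp classical_sets functions cardinality.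
From mathcomp Require Import fsbigop filter complex reals.
Import Order.TTheory GRing.Theory Num.Theory.

Set Implicit Arguments.
Unset Strict Implicit.
Unset Printing Implicit Defensive.

Local Open Scope ring_scope.

(** * Row recursion for Jacobi-Trudi determinants *)

Section Offsets.
Variable l : nat.

(** Position of row [r] in the sweep of letter [c]: odd numbers are positive letters, swept from the
    bottom row up, and even ones are negative, swept from the top row down. [move_rank] numbers all
    moves consecutively, one sweep after another. *)
Definition offset (c r : nat) : nat := if odd c then (l - r.+1)%N else r.
Definition move_rank (c r : nat) : nat := (c * l + offset c r)%N.

Lemma offset_lt c (r : 'I_l) : (offset c r < l)%N.
Proof. by rewrite /offset; have := ltn_ord r; case: odd; lia. Qed.

Lemma offset_inj c (r s : 'I_l) : (offset c r == offset c s) = (r == s).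
Proof.
apply/eqP/eqP => [|-> //]; rewrite /offset => rs; apply: val_inj => /=.
by move: rs; have := ltn_ord r; have := ltn_ord s; case: odd; lia.
Qed.

Lemma offset_surj c s : (s < l)%N -> exists r : 'I_l, offset c r = s.
Proof.
move=> sl; have rl : (offset c s < l)%N by rewrite /offset; case: odd; lia.
by exists (Ordinal rl); rewrite /= /offset; case: odd; lia.
Qed.

Lemma move_rank_lt K (c : 'I_K) (r : 'I_l) : (move_rank c r < K * l)%N.
Proof.
apply: leq_trans (_ : (c.+1 * l <= _)%N); last first.
  by rewrite leq_pmul2r ?ltn_ord // (leq_ltn_trans _ (ltn_ord r)).
by rewrite /move_rank mulSn addnC ltn_add2r offset_lt.
Qed.

Lemma move_rank_inj K : injective (fun x : 'I_K * 'I_l => move_rank x.1 x.2).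
Proof.
move=> [c r] [d s]; rewrite /move_rank /= => cd.
have l0 : (0 < l)%N := leq_ltn_trans (leq0n _) (ltn_ord r).
have e : c = d.
  apply: val_inj; move: (congr1 (divn^~ l) cd) => /=.
  by rewrite !divnMDl // !divn_small ?offset_lt // !addn0.
by move: cd; rewrite e => /addnI/eqP; rewrite offset_inj => /eqP ->.
Qed.

(* The number of letters c with move_rank c r < p. *)
Definition alph (p r : nat) : nat := (p %/ l + (offset (p %/ l) r < p %% l))%N.

(** The case [s = l] is included: the end of one sweep is the start of the next. Times [p] and
    [p + 1] can thus be compared even at the last move of a sweep. *)
Lemma alphE c s (r : 'I_l) : (s <= l)%N ->
  alph (c * l + s) r = (c + (offset c r < s))%N.
Proof.
have l0 : (0 < l)%N := leq_ltn_trans (leq0n _) (ltn_ord r).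
rewrite /alph leq_eqVlt => /predU1P[->|sl].
  by rewrite -mulSnr mulnK // modnMl ltn0 addn0 offset_lt addn1.
by rewrite divnMDl // modnMDl divn_small // modn_small // addn0.
Qed.

End Offsets.

(** * Words of moves, a move being a letter together with a row *)

Section Words.
Variables (l K : nat).
Implicit Types (a b : {ffun 'I_l -> int}).

Definition decreasing a : bool := [forall i : 'I_l, forall j : 'I_l, (i < j)%N ==> (a j < a i)].

Lemma decreasingP a :
  reflect (forall i j : 'I_l, (i < j)%N -> a j < a i) (decreasing a).
Proof.
apply: (iffP fintype.forallP) => [H i j ij|H i].
  by have /fintype.forallP/(_ j) := H i; rewrite ij.
by apply/fintype.forallP => j; apply/implyP; apply: H.
Qed.

Definition lower a (r : 'I_l) : {ffun 'I_l -> int} := [ffun i => a i - (i == r)%:Z].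

Lemma sum_lower a r : \sum_i lower a r i = \sum_i a i - 1.
Proof.
under eq_bigr do rewrite ffunE.
rewrite big_split /= sumrN; congr (_ - _).
by rewrite (bigD1 r) //= eqxx big1 ?addr0 // => i /negPf ->.
Qed.

(** For a positive letter the shortened row keeps that letter at its disposal, so the same move may
    be repeated; for a negative letter it may not. *)
Definition precedes (x y : 'I_K * 'I_l) : bool :=
  (move_rank l x.1 x.2 < move_rank l y.1 y.2 + odd y.1)%N.

Definition word_shape b n (w : {ffun 'I_n -> 'I_K * 'I_l}) (k : nat) : {ffun 'I_l -> int} :=
  [ffun i => b i + (\sum_(v < n) ((v < k)%N && ((w v).2 == i)))%N%:Z].

Definition valid_word b n p a (w : {ffun 'I_n -> 'I_K * 'I_l}) : bool :=
  [&& [forall v, (move_rank l (w v).1 (w v).2 < p)%N],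
      [forall v : 'I_n, forall u : 'I_n, (v < u)%N ==> precedes (w v) (w u)],
      [forall k : 'I_n, decreasing (word_shape b w k)]
    & word_shape b w n == a].

Definition snoc (A : finType) n (w : {ffun 'I_n -> A}) (x : A) : {ffun 'I_n.+1 -> A} :=
  [ffun i : 'I_n.+1 => if insub (i : nat) is Some j then w j else x].

Lemma snoc_widen (A : finType) n (w : {ffun 'I_n -> A}) x j :
  snoc w x (widen_ord (leqnSn n) j) = w j.
Proof.
by rewrite ffunE /= valK.
Qed.

Lemma snoc_max (A : finType) n (w : {ffun 'I_n -> A}) x : snoc w x ord_max = x.
Proof. by rewrite ffunE /= insubF // ltnn. Qed.

Lemma big_snoc (R : nmodType) (A : finType) n (P : pred {ffun 'I_n.+1 -> A}) F :
  \sum_(w | P w) F w =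
  \sum_(x : A) \sum_(w : {ffun 'I_n -> A} | P (snoc w x)) F (snoc w x) :> R.
Proof.
rewrite pair_big_dep (reindex (fun y => snoc y.2 y.1)) //=.
exists (fun w : {ffun 'I_n.+1 -> A} =>
  (w ord_max, [ffun j => w (widen_ord (leqnSn n) j)])) => [[x w] _|w _] /=.
  by rewrite snoc_max; congr pair; apply/ffunP => j; rewrite ffunE snoc_widen.
apply/ffunP => i; rewrite ffunE; case: insubP => [j _ ji|].
  by rewrite ffunE; congr (w _); apply: val_inj.
rewrite -leqNgt => ni; congr (w _); apply: val_inj => /=.
by apply/eqP; rewrite eqn_leq ni /= -ltnS ltn_ord.
Qed.

Lemma forall_snoc n (P : pred 'I_n.+1) :
  [forall i, P i] = [forall i : 'I_n, P (widen_ord (leqnSn n) i)] && P ord_max.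
Proof.
apply/fintype.forallP/andP => [H|[/fintype.forallP H1 H2] i]; first by split=> //; apply/fintype.forallP.
have [[j ->]|->] // : (exists j, i = widen_ord (leqnSn n) j) \/ i = ord_max.
have := ltn_ord i; rewrite ltnS leq_eqVlt => /predU1P[e|lt]; [right|left].
  exact: val_inj.
by exists (Ordinal lt); apply: val_inj.
Qed.

Lemma word_shape_snoc_le b n (w : {ffun 'I_n -> 'I_K * 'I_l}) x k : (k <= n)%N ->
  word_shape b (snoc w x) k = word_shape b w k.
Proof.
move=> kn; apply/ffunP => i; rewrite !ffunE big_ord_recr /= ltnNge kn addn0.
by congr (_ + Posz _); apply: eq_bigr => v _; rewrite snoc_widen.
Qed.

Lemma word_shape_snoc b n (w : {ffun 'I_n -> 'I_K * 'I_l}) x a :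
  (word_shape b (snoc w x) n.+1 == a) = (word_shape b w n == lower a x.2).
Proof.
have e i : word_shape b (snoc w x) n.+1 i = word_shape b w n i + (i == x.2)%:Z.
  rewrite !ffunE big_ord_recr /= ltnSn snoc_max [x.2 == i]eq_sym PoszD addrA.
  congr (_ + Posz _ + _); apply: eq_bigr => v _.
  by rewrite snoc_widen !ltnS (ltnW (ltn_ord _)) ltn_ord.
apply/eqP/eqP => /ffunP H; apply/ffunP => i.
  by rewrite [RHS]ffunE -H e addrK.
by rewrite e H ffunE subrK.
Qed.

Lemma precedes_trans : transitive precedes.
Proof. by move=> y x z; rewrite /precedes; do 2 case: odd; lia. Qed.

(** The last move bounds all earlier ones, so that [move_rank] of [x] plus its parity takes over the
    part of [p]. The determinants obey the same recursion. *)
Lemma valid_snoc b n p a (w : {ffun 'I_n -> 'I_K * 'I_l}) x :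
  valid_word b p a (snoc w x) =
  [&& (move_rank l x.1 x.2 < p)%N, decreasing (lower a x.2)
    & valid_word b (move_rank l x.1 x.2 + odd x.1) (lower a x.2) w].
Proof.
rewrite /valid_word [X in X && _]forall_snoc [X in _ && (X && _)]forall_snoc.
rewrite [X in _ && (_ && (X && _))]forall_snoc !snoc_max word_shape_snoc word_shape_snoc_le //=.
have -> : [forall i : 'I_n, decreasing (word_shape b (snoc w x) (widen_ord (leqnSn n) i))]
   = [forall k : 'I_n, decreasing (word_shape b w k)].
  by apply: eq_forallb => v /=; rewrite word_shape_snoc_le // ltnW.
have -> : [forall u : 'I_n.+1, (@ord_max n < u)%N ==> precedes x (snoc w x u)].
  by apply/fintype.forallP => u /=; rewrite ltnNge -ltnS ltn_ord.
rewrite andbT.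
have -> : [forall i : 'I_n, forall u : 'I_n.+1, (widen_ord (leqnSn n) i < u)%N ==>
      precedes (snoc w x (widen_ord (leqnSn n) i)) (snoc w x u)] =
   [forall v, (move_rank l (w v).1 (w v).2 < move_rank l x.1 x.2 + odd x.1)%N] &&
   [forall v : 'I_n, forall u : 'I_n, (v < u)%N ==> precedes (w v) (w u)].
  apply/fintype.forallP/andP => [H|[/fintype.forallP H1 /fintype.forallP H2] v].
    split; apply/fintype.forallP => v; have := H v; rewrite forall_snoc => /andP[/fintype.forallP H1].
      by rewrite snoc_max snoc_widen /= ltn_ord.
    by move=> _; apply/fintype.forallP => u; have := H1 u; rewrite !snoc_widen.
  rewrite forall_snoc snoc_max snoc_widen [precedes _ x]H1 implybT andbT.
  apply/fintype.forallP => u; rewrite snoc_widen.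
  exact: (fintype.forallP (H2 v)).
have -> : [forall i : 'I_n, (move_rank l (snoc w x (widen_ord (leqnSn n) i)).1
    (snoc w x (widen_ord (leqnSn n) i)).2 < p)%N] =
    [forall v, (move_rank l (w v).1 (w v).2 < p)%N].
  by apply: eq_forallb => v; rewrite snoc_widen.
apply/idP/idP.
  case/and4P => /andP[H1 H2] /andP[H3 H4] /andP[H5 H6] H7.
  by rewrite H2 H3 H4 H5 H7 -(eqP H7) H6.
case/and3P => H2 H8 /and4P[H3 H4 H5 H7]; rewrite H3 H4 H5 H2 (eqP H7) H8 /= andbT eqxx !andbT.
apply/fintype.forallP => v; have := fintype.forallP H3 v; move: H2; case: odd; lia.
Qed.

End Words.

(** * Determinants with row-dependent letter bounds, expanded over words *)

Section RowRecursion.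
Variables (A : comNzRingType) (l K : nat) (wt : nat -> A) (H : nat -> int -> A).
Variable b : {ffun 'I_l -> int}.
Hypotheses (H0 : forall n, H 0 n = (n == 0)%:R)
  (Hneg : forall c n, n < 0 -> H c n = 0)
  (HS : forall c n, H c.+1 n = H c n + wt c * H (c + odd c) (n - 1)).
Implicit Type a : {ffun 'I_l -> int}.

(** Row [i] uses the letters that it has passed after [p] moves. The vectors [a] and [b] hold row
    lengths shifted by the row index, so [a i - b j] is the usual Jacobi-Trudi index. *)
Definition mixed_det p a : A := \det (\matrix_(i, j) H (alph l p i) (a i - b j)).

(** Move [p] raises the bound of row [r] alone, from [c] to [c + 1], so [HS] and linearity in that
    row apply. At time [p + odd c] row [r] has exactly the bound [c + odd c] that [HS] asks for, and
    the other rows are as before. *)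
Lemma mixed_det_step p c (r : 'I_l) a : p = move_rank l c r ->
  mixed_det p.+1 a = mixed_det p a + wt c * mixed_det (p + odd c) (lower a r).
Proof.
move=> ->; have ol := offset_lt c r.
have alphr e (i : 'I_l) : (e <= 1)%N ->
    alph l (move_rank l c r + e) i = (c + (offset l c i < offset l c r + e))%N.
  by move=> e1; rewrite /move_rank -addnA alphE //; move: ol; lia.
have alph_ne e (i : 'I_l) : (e <= 1)%N -> i != r ->
    alph l (move_rank l c r + e) i = alph l (move_rank l c r) i.
  move=> e1 ir; rewrite -[in RHS](addn0 (move_rank l c r)) !alphr // addn0.
  by congr (c + nat_of_bool _)%N; move: ir e1; rewrite -(offset_inj c); lia.
have e1 : (odd c <= 1)%N by case: odd.
rewrite -[mixed_det (move_rank l c r) a]mul1r -addn1.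
apply: (@determinant_multilinear _ _ _ _ _ r).
- apply/rowP => j; rewrite !mxE alphr // ffunE eqxx addn1 ltnSn addn1 HS mul1r.
  rewrite -[in X in _ = X + _](addn0 (move_rank l c r)) !alphr // addn0 ltnn addn0.
  congr (_ + _ * H (c + _) _); last by rewrite addrAC.
  by case: odd; rewrite ?addn1 ?ltnSn ?addn0 ?ltnn.
- by apply/matrixP => i j; rewrite !mxE alph_ne // eq_sym neq_lift.
- apply/matrixP => i j; rewrite !mxE !alph_ne // 1?eq_sym ?neq_lift // ffunE.
  by rewrite eq_sym (negPf (neq_lift _ _)) subr0.
Qed.

(** Lowering entry [r] destroys strict decrease only if it meets the entry of row [r + 1]. At this
    time both rows have the same bound: [c + 1] if [c] is odd, the sweep having come from below, and
    [c] if [c] is even, the sweep not having reached either row. Hence two rows coincide. *)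
Lemma mixed_det_lower0 c (r : 'I_l) a : decreasing a -> ~~ decreasing (lower a r) ->
  mixed_det (move_rank l c r + odd c) (lower a r) = 0.
Proof.
move=> /decreasingP da; rewrite negb_forall.
case/fintype.existsP => i; rewrite negb_forall.
case/fintype.existsP => j; rewrite negb_imply -leNgt !ffunE => /andP[ij].
have aij := da _ _ ij.
have [ir|ir] := eqVneq i r; last by case: eqP => _ ?; lia.
rewrite {i}ir in ij aij *.
rewrite [j == r]eq_sym -[r == j]val_eqE (ltn_eqF ij) subr0 => arj.
have ej : j = r.+1 :> nat.
  apply/eqP; rewrite eqn_leq ij andbT leqNgt; apply/negP => rj.
  have kl : (r.+1 < l)%N := ltn_trans rj (ltn_ord j).
  have := da (Ordinal kl) j rj; have := da r (Ordinal kl) (ltnSn r); lia.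
have rj : r != j by rewrite -val_eqE (ltn_eqF ij).
apply: (determinant_alternate rj) => k; rewrite !mxE !ffunE eqxx eq_sym (negPf rj).
have alphr (i : 'I_l) :
    alph l (move_rank l c r + odd c) i = (c + (offset l c i < offset l c r + odd c))%N.
  by have := offset_lt c r; rewrite /move_rank -addnA => ?; rewrite alphE //; case: odd; lia.
congr (H _ _); last by lia.
by rewrite !alphr /offset; have := ltn_ord j; case: odd; lia.
Qed.

Lemma mixed_det_sum p a : (p <= K * l)%N ->
  mixed_det p a = mixed_det 0 a +
    \sum_(x : 'I_K * 'I_l | (move_rank l x.1 x.2 < p)%N)
      wt x.1 * mixed_det (move_rank l x.1 x.2 + odd x.1) (lower a x.2).
Proof.
elim: p => [|p IH] pK; first by rewrite big_pred0 ?addr0.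
have l0 : (0 < l)%N by case: (l) pK => //; rewrite muln0.
have cK : (p %/ l < K)%N by rewrite ltn_divLR.
have [r er] : exists r : 'I_l, offset l (p %/ l) r = (p %% l)%N.
  by apply: offset_surj; rewrite ltn_mod.
have ep : p = move_rank l (p %/ l) r by rewrite /move_rank er -divn_eq.
rewrite (mixed_det_step _ ep) IH ?(ltnW pK) // -addrA; congr (_ + _).
rewrite [RHS](bigD1 (Ordinal cK, r)) /= -?ep // addrC; congr (_ + _).
apply: eq_bigl => x; rewrite ltnS (leq_eqVlt (move_rank _ _ _) p).
have [->|xp] /= := eqVneq x (Ordinal cK, r); first by rewrite -ep ltnn !andbF.
rewrite !andbT; case: eqP => // e.
by case/eqP: xp; apply: (@move_rank_inj l K) => /=; rewrite e -ep.
Qed.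

(** In each term of the permutation expansion some factor has a negative index; otherwise
    [b (s i) <= a i] for all [i], and summation contradicts the hypothesis. *)
Lemma mixed_det_lt p a : \sum_i a i < \sum_i b i -> mixed_det p a = 0.
Proof.
move=> ab; rewrite /mixed_det /determinant big1 // => s _.
have [i ai|ge] := pickP (fun i => a i < b (s i)).
  by rewrite (bigD1 i) //= mxE Hneg ?mul0r ?mulr0 // subr_lt0.
suff : \sum_i b i <= \sum_i a i by rewrite leNgt ab.
rewrite (reindex_inj (@perm_inj _ s)) /=; apply: ler_sum => i _.
by rewrite leNgt ge.
Qed.

(** Without letters the entries are Kronecker deltas of [a i] and [b j]. For [a] different from [b]
    some row vanishes, since two strictly decreasing vectors with every [a i] among the [b j] are
    equal. *)
Lemma mixed_det0 a : decreasing a -> decreasing b -> mixed_det 0 a = (a == b)%:R.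
Proof.
move=> /decreasingP da /decreasingP db.
have al (i : 'I_l) : alph l 0 i = 0%N by rewrite /alph div0n mod0n ltn0.
have inj (f : {ffun 'I_l -> int}) : (forall i j : 'I_l, (i < j)%N -> f j < f i) -> injective f.
  move=> df i j fij; apply: val_inj => /=; case: (ltngtP i j) => // /df; rewrite fij ltxx //.
have [->|ab] := eqVneq a b.
  rewrite /mixed_det (_ : matrix_of_fun _ _ = 1%:M) ?det1 //.
  apply/matrixP => i j; rewrite !mxE al H0 subr_eq0.
  by rewrite (inj_eq (inj _ db)).
have [s|] := boolP [exists i, [forall j, a i != b j]].
  case/fintype.existsP: s => i /fintype.forallP ne.
  rewrite /mixed_det (expand_det_row _ i) big1 // => j _.
  by rewrite !mxE al H0 subr_eq0 (negPf (ne j)) mul0r.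
rewrite negb_exists => /fintype.forallP sur; case/eqP: ab.
have {}sur (i : 'I_l) : exists j, a i = b j.
  by have := sur i; rewrite negb_forall => /fintype.existsP[j]; rewrite negbK => /eqP; exists j.
have [s es] := fin_all_exists sur.
(* A strictly increasing self-map of the row indices is the identity; [sid] and [sid'] bound it from
   the two ends. *)
have smon (i j : 'I_l) : (i < j)%N -> (s i < s j)%N.
  move=> /da; rewrite !es => sij; rewrite ltnNge leq_eqVlt; apply/negP.
  by case/predU1P => [/val_inj e|/db]; [rewrite e ltxx in sij|lia].
have sid m (i : 'I_l) : i = m :> nat -> (m <= s i)%N.
  elim: m i => // m IH i im.
  have ml : (m < l)%N by rewrite -im ltnW // im ltnS leqnn || (have := ltn_ord i; lia).
  by have := IH (Ordinal ml) erefl; have := smon (Ordinal ml) i; rewrite /= im ltnSn; lia.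
have sid' m (i : 'I_l) : (l - i.+1)%N = m :> nat -> (s i <= i)%N.
  elim: m i => [|m IH] i im; first by have := ltn_ord (s i); have := ltn_ord i; lia.
  have ml : (i.+1 < l)%N by lia.
  have := smon i (Ordinal ml) (ltnSn i).
  by have := IH (Ordinal ml); rewrite /=; lia.
apply/ffunP => i; rewrite es; congr (b _); apply: val_inj; apply/eqP => /=.
by rewrite eqn_leq (sid' _ i erefl) (sid _ i erefl).
Qed.

Lemma mixed_det_words n p a : decreasing b -> decreasing a ->
    \sum_i a i = \sum_i b i + n%:Z -> (p <= K * l)%N ->
  mixed_det p a = \sum_(w : {ffun 'I_n -> 'I_K * 'I_l} | valid_word b p a w)
    \prod_v wt (w v).1.
Proof.
move=> db; elim: n p a => [|n IH] p a da ab pK; rewrite mixed_det_sum //.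
  rewrite [X in _ + X]big1 ?addr0; last first.
    (* The entries of [a] and [b] have equal sums here, so any lowered vector has too small a
       sum. *)
    move=> x _; rewrite mixed_det_lt ?mulr0 //.
    by rewrite sum_lower ab; lia.
  pose w0 : {ffun 'I_0 -> 'I_K * 'I_l} := ffun0 (card_ord 0).
  have w0P w : w = w0 by apply/ffunP => -[].
  have vw : valid_word b p a w0 = (a == b).
    rewrite /valid_word.
    have -> : word_shape b w0 0 = b by apply/ffunP => i; rewrite ffunE big_ord0 addr0.
    rewrite eq_sym; case: eqP; rewrite ?andbF // => _; rewrite andbT.
    by apply/and3P; split; apply/fintype.forallP => -[].
  rewrite mixed_det0 // (eq_bigl (fun w => (a == b) && (w == w0))); last first.
    by move=> w; rewrite (w0P w) vw eqxx andbT.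
  case: eqP => _ /=; last by rewrite big_pred0.
  by rewrite big_pred1_eq big_ord0.
rewrite mixed_det0 //; have /negPf -> : a != b.
  by apply/eqP => e; move: ab; rewrite e; lia.
rewrite add0r big_snoc big_mkcond /=; apply: eq_bigr => x _.
have [lt|ge] := ltnP; last by rewrite big_pred0 // => w; rewrite valid_snoc ltnNge ge.
have [dx|ndx] := boolP (decreasing (lower a x.2)); last first.
  rewrite mixed_det_lower0 // mulr0 big_pred0 // => w.
  by rewrite valid_snoc (negPf ndx) andbF.
rewrite IH //; first last.
- by have := move_rank_lt x.1 x.2; case: odd; lia.
- by rewrite sum_lower ab; lia.
rewrite big_distrr /=; apply: eq_big => w; first by rewrite valid_snoc lt dx.
move=> _; rewrite big_ord_recr /= snoc_max mulrC; congr (_ * _).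
by apply: eq_bigr => v _; rewrite snoc_widen.
Qed.

End RowRecursion.

(** * Words and standard tableaux *)

(** The relation [S] matches the indices satisfying [P] with those satisfying [Q] one to one; using
    a relation avoids building two inverse maps. *)
Lemma reindex_rel (V : nmodType) (I J : finType) (P : pred I) (Q : pred J)
    (S : I -> J -> bool) (F : I -> V) (G : J -> V) :
    (forall i, P i -> exists2 j, Q j & S i j) ->
    (forall j, Q j -> exists2 i, P i & S i j) ->
    (forall i j j', P i -> S i j -> S i j' -> j = j') ->
    (forall i i' j, P i -> P i' -> S i j -> S i' j -> i = i') ->
    (forall i j, P i -> Q j -> S i j -> F i = G j) ->
  \sum_(i | P i) F i = \sum_(j | Q j) G j.
Proof.
move=> PQ QP uJ uI FG.
transitivity (\sum_(i | P i) \sum_(j | Q j && S i j) G j).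
  apply: eq_bigr => i Pi; have [j Qj Sij] := PQ i Pi.
  rewrite (big_pred1 j) ?(FG i j) // => j'.
  by apply/andP/eqP => [[_ /uJ]|->] //; apply.
rewrite (exchange_big_dep Q) /=; last by move=> i j _ /andP[].
apply: eq_bigr => j Qj; have [i Pi Sij] := QP j Qj.
rewrite (big_pred1 i) // => i' /=; rewrite Qj /=.
by apply/andP/eqP => [[Pi' S']|->] //; apply: uI S' Sij.
Qed.

Lemma ord_chain (X : Type) (e : rel X) n (w : 'I_n -> X) : transitive e ->
  (forall v u : 'I_n, u = v.+1 :> nat -> e (w v) (w u)) ->
  forall v u : 'I_n, (v < u)%N -> e (w v) (w u).
Proof.
move=> tr step v u; move d : (u - v)%N => m; elim: m v d => [|m IH] v; first by lia.
move=> d vu; have v1 : (v.+1 < n)%N := leq_ltn_trans vu (ltn_ord u).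
have e1 := step v (Ordinal v1) erefl.
case: (ltnP v.+1 u) => [lt|ge]; last first.
  by rewrite (_ : u = Ordinal v1) //; apply: val_inj => /=; lia.
by apply: tr e1 (IH (Ordinal v1) _ lt) => /=; lia.
Qed.

(** For equal letters the direction of the sweep decides: a positive letter continues in a weakly
    higher row, a negative one in a strictly lower row. This becomes the dichotomy between
    non-descents and descents. *)
Lemma precedesE l K (x y : 'I_K * 'I_l) : precedes x y =
  (x.1 < y.1)%N || (x.1 == y.1) && (odd x.1 == (y.2 <= x.2)%N).
Proof.
case: x y => [c r] [d s]; rewrite /precedes /=.
have cr := offset_lt c r; have ds := offset_lt d s.
rewrite -[c == d]val_eqE /move_rank /=; case: (ltngtP c d) => [cd|cd|cd] //=.
- have : (c.+1 * l <= d * l)%N by rewrite leq_mul2r cd orbT.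
  by rewrite mulSn; lia.
- have : (d.+1 * l <= c * l)%N by rewrite leq_mul2r cd orbT.
  by rewrite mulSn; case: (odd d) => /=; lia.
rewrite (val_inj cd) /offset; have := ltn_ord r; have := ltn_ord s.
by case: (odd d); lia.
Qed.

(** * Counting the entries below a bound in each row *)

Section Count.
Variables (n l : nat) (row : 'I_n -> 'I_l).

Definition row_count (k : nat) (i : 'I_l) : nat :=
  (\sum_(v < n) ((v < k)%N && (row v == i)))%N.

Lemma row_countS (k : 'I_n) i : row_count k.+1 i = (row_count k i + (row k == i))%N.
Proof.
rewrite /row_count (bigD1 k) //= ltnSn addnC [in RHS](bigD1 k) //= ltnn add0n.
congr (_ + _)%N; apply: eq_bigr => v vk.
by rewrite ltnS [(v <= k)%N]leq_eqVlt (negPf (vk : val v != val k)).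
Qed.

Lemma row_count0 i : row_count 0 i = 0%N.
Proof. by rewrite /row_count big1. Qed.

Lemma leq_row_count k k' i : (k <= k')%N -> (row_count k i <= row_count k' i)%N.
Proof.
move=> kk; apply: leq_sum => v _; case: (ltnP v k) => //= vk.
by rewrite (leq_trans vk kk).
Qed.

Lemma row_count_eq k k' i : (k <= k')%N ->
    (forall v : 'I_n, row v = i -> (k <= v < k')%N -> False) ->
  row_count k' i = row_count k i.
Proof.
move=> kk no; apply: eq_bigr => v _; case: eqP => [rv|]; rewrite ?andbF // !andbT.
by have := no v rv; case: (leqP k v); case: (ltnP v k'); lia.
Qed.

Lemma row_count_inj v u : row v = row u -> row_count v (row v) = row_count u (row u) ->
  v = u.
Proof.
move=> rvu e; apply: val_inj => /=; case: (ltngtP v u) => // lt.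
- have := leq_row_count (row v) lt.
  by rewrite row_countS eqxx e rvu; lia.
- have := leq_row_count (row v) lt.
  by rewrite rvu row_countS eqxx -rvu e rvu; lia.
Qed.

Lemma row_count_onto k m i : (k <= n)%N -> (m < row_count k i)%N ->
  exists2 v, row v = i & row_count v i = m.
Proof.
elim: k => [|k IH] kn; first by rewrite row_count0.
rewrite (row_countS (Ordinal kn)) /=.
case: (ltnP m (row_count k i)) => [lt _|ge]; first by apply: IH lt; exact: ltnW.
by case: eqP => [rk|]; [exists (Ordinal kn) => //=; lia|lia].
Qed.

End Count.

Lemma partition_nth s i j : is_partition s -> (i <= j)%N -> (nth 0%N s j <= nth 0%N s i)%N.
Proof.
case/andP => so _ ij; case: (ltnP j (size s)) => js; last by rewrite [nth 0%N s j]nth_default.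
have tr : transitive geq by move=> y x z /= yx zy; exact: leq_trans zy yx.
by apply: (sorted_leq_nth tr (fun x => leqnn x) 0%N so) => //; rewrite inE (leq_ltn_trans ij).
Qed.

(** * The correspondence between words and pairs of a standard tableau and a letter sequence *)

Section Skew.
Variables (la mu : seq nat).
Hypothesis skew : is_skew_shape la mu.
Local Notation l := (size la).

Lemma skew_la : is_partition la. Proof. by case/and4P: skew. Qed.
Lemma skew_mu : is_partition mu. Proof. by case/and4P: skew. Qed.

Lemma skew_leq i : (nth 0%N mu i <= nth 0%N la i)%N.
Proof.
case/and4P: skew => _ _ _ /fintype.forallP H; case: (ltnP i (size mu)) => im.
  exact: H (Ordinal im).
by rewrite nth_default.
Qed.

Lemma ex_box (i : 'I_l) j : (nth 0%N mu i <= j < nth 0%N la i)%N ->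
  exists2 b : box la mu, (val b).1 = i & bcol b = j.
Proof.
move=> ij; have jh : (j < head 0 la)%N.
  case/andP: ij => _ /leq_trans; apply.
  by rewrite -nth0; apply: partition_nth skew_la _.
by exists (exist _ (i, Ordinal jh) ij).
Qed.

Lemma boxP (b : box la mu) :
  (nth 0%N mu (val b).1 <= bcol b < nth 0%N la (val b).1)%N.
Proof. exact: (valP b). Qed.

Lemma box_inj (b c : box la mu) : (val b).1 = (val c).1 -> bcol b = bcol c -> b = c.
Proof.
move=> bc1 bc2; apply: val_inj; move: bc1 bc2; rewrite /bcol.
by case: (val b) (val c) => [? ?] [? ?] /= -> /val_inj ->.
Qed.

(** The shift by the row index makes weakly decreasing row lengths strictly decreasing. Both shapes
    are padded with zeros to [size la] rows. *)
Definition beta (s : seq nat) : {ffun 'I_l -> int} := [ffun i : 'I_l => (nth 0%N s i)%:Z - i%:Z].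

Section Rows.
Variables (n : nat) (T : {ffun box la mu -> 'I_n}) (row : 'I_n -> 'I_l).
Hypotheses (sytT : is_SYT T) (rowT : forall b, row (T b) = (val b).1).

Lemma SYT_fiber v : exists b, forall c, T c = v <-> c = b.
Proof.
case/and3P: sytT => /fintype.forallP/(_ v)/card1P[b bv] _ _; exists b => c.
(* The fibre in [is_SYT] is a classical set, whose membership test is an [asbool]. *)
have e : (T c == v) = (c == b) by rewrite -[LHS]boolp.asboolb; exact: bv c.
by split=> /eqP h; apply/eqP; rewrite ?e // -e.
Qed.

Lemma SYT_surj v : exists b, T b = v.
Proof. by have [b bv] := SYT_fiber v; exists b; apply/bv. Qed.

Lemma SYT_row b c : (val b).1 = (val c).1 -> (bcol b < bcol c)%N -> (T b < T c)%N.
Proof.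
move=> bc1 bc2; case/and3P: sytT => _ /fintype.forallP/(_ b)/fintype.forallP/(_ c) + _.
by rewrite /brow bc1 eqxx bc2.
Qed.

Lemma SYT_col b c : bcol b = bcol c -> ((val b).1 < (val c).1)%N -> (T b < T c)%N.
Proof.
move=> bc1 bc2; case/and3P: sytT => _ _ /fintype.forallP/(_ b)/fintype.forallP/(_ c).
by rewrite /brow bc1 eqxx bc2.
Qed.

Lemma SYT_rowE b c : (val b).1 = (val c).1 -> (T b < T c)%N = (bcol b < bcol c)%N.
Proof.
move=> bc; apply/idP/idP => [lt|]; last exact: SYT_row.
rewrite ltnNge leq_eqVlt; apply/negP => /predU1P[e|/(SYT_row (esym bc))]; last by lia.
by move: lt; rewrite (box_inj bc (esym e)) ltnn.
Qed.

(** Induction along the row: between the entry of the left neighbour and [T b] there is no further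
    entry of that row. The column of a box is thus determined by the order in which its row fills
    up. *)
Lemma SYT_count b : bcol b = (nth 0%N mu (val b).1 + row_count row (T b) (val b).1)%N.
Proof.
have /andP[mb _] := boxP b; rewrite -[LHS](subnKC mb); congr (_ + _)%N.
move: {1 3}(bcol b - _)%N (erefl (bcol b - nth 0%N mu (val b).1)%N) => m em.
elim: m b mb em => [|m IH] b mb em; symmetry.
  rewrite (row_count_eq (k := 0)) ?row_count0 // => v rv /= vT.
  have [c cv] := SYT_surj v; rewrite -{}cv rowT in rv vT.
  by move: vT; rewrite (SYT_rowE rv); have /andP[+ _] := boxP c; rewrite rv; lia.
have [|b' b'1 b'2] := @ex_box (val b).1 (bcol b).-1.
  by have := boxP b; lia.
have bb : (T b' < T b)%N by rewrite SYT_rowE //; lia.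
have := IH b'; rewrite b'1 => IHb.
rewrite (row_count_eq (k := (T b').+1)) // => [|v rv vT].
  by rewrite row_countS rowT b'1 eqxx addn1 -IHb //; lia.
have [c cv] := SYT_surj v; rewrite -{}cv rowT in rv vT.
by move: vT; rewrite !SYT_rowE ?b'1 //; lia.
Qed.

Lemma SYT_row_count_size (i : 'I_l) : (nth 0%N mu i + row_count row n i)%N = nth 0%N la i.
Proof.
have := skew_leq i; rewrite leq_eqVlt => /predU1P[e|lt].
  rewrite (row_count_eq (k := 0)) ?row_count0 ?addn0 // => v rv _.
  by have [b bv] := SYT_surj v; move: rv; rewrite -bv rowT => bi; have := boxP b; rewrite bi; lia.
have [|b b1 b2] := @ex_box i (nth 0%N la i).-1; first by lia.
have := SYT_count b; rewrite b1 b2 => sb.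
rewrite (row_count_eq (k := (T b).+1)) // => [|v rv vT].
  by rewrite row_countS rowT b1 eqxx; lia.
have [c cv] := SYT_surj v; rewrite -{}cv rowT in rv vT.
by move: vT; rewrite !SYT_rowE ?b1 //; have := boxP c; rewrite rv; lia.
Qed.

(** The entries below [k], together with [mu], occupy a partition shape, because a box can be filled
    only after the boxes above it. *)
Lemma SYT_partial k (i j : 'I_l) : (k <= n)%N -> (i < j)%N ->
  (nth 0%N mu j + row_count row k j <= nth 0%N mu i + row_count row k i)%N.
Proof.
move=> kn ij; elim: k kn => [|k IH] kn.
  by rewrite !row_count0 !addn0; apply: partition_nth skew_mu (ltnW ij).
rewrite !(row_countS _ (Ordinal kn)) /=; have {IH} := IH (ltnW kn).
case: (eqVneq (row _) j) => [rj|_]; last by lia.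
have [c ck] := SYT_surj (Ordinal kn).
have cj : (val c).1 = j by rewrite -rowT ck.
have := SYT_count c; rewrite ck cj /= => sc _.
have -> : (row (Ordinal kn) == i) = false by rewrite rj -val_eqE gtn_eqF.
case: (ltnP (bcol c) (nth 0%N mu i)) => [lt|ge]; first by lia.
(* Outside [mu], the box of row [i] in the column of [c] lies in the diagram; its entry is below
   [k], so row [i] already extends past that column. *)
have [|d d1 d2] := @ex_box i (bcol c).
  have := partition_nth skew_la (ltnW ij); have := boxP c; rewrite cj; lia.
have dk : (T d < k)%N by rewrite -[k]/(val (Ordinal kn)) -ck; apply: SYT_col; rewrite ?d1 ?cj.
have := SYT_count d; rewrite d1 d2 => sd.
by have := leq_row_count row i dk; rewrite row_countS rowT d1 eqxx; lia.
Qed.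

End Rows.

(** The terms of the fundamental series of [I], listed by position: a weakly increasing sequence
    with ties only for positive letters outside [I] and negative letters in [I]. *)
Definition compat n K (I : {set 'I_n.-1}) (z : {ffun 'I_n -> 'I_K}) : bool :=
  [forall i : 'I_n.-1, forall v : 'I_n, forall u : 'I_n,
    (v == i :> nat) && (u == i.+1 :> nat) ==>
    (z v < z u)%N || (z v == z u) && (odd (z v) == (i \notin I))].

Lemma compatP n K (I : {set 'I_n.-1}) (z : {ffun 'I_n -> 'I_K}) :
  reflect (forall (i : 'I_n.-1) (v u : 'I_n), v = i :> nat -> u = i.+1 :> nat ->
      (z v < z u)%N || (z v == z u) && (odd (z v) == (i \notin I)))
    (compat I z).
Proof.
apply: (iffP fintype.forallP) => [H i v u vi ui|H i].
  by have /fintype.forallP/(_ v)/fintype.forallP/(_ u) := H i; rewrite vi ui !eqxx.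
apply/fintype.forallP => v; apply/fintype.forallP => u; apply/implyP => /andP[/eqP vi /eqP ui].
exact: H.
Qed.

Variables (A : comNzRingType) (K n : nat) (wt : nat -> A).

(** Position [v] of the word records the row of the box containing [v] and the letter [z v]. *)
Definition reading (x : {ffun box la mu -> 'I_n} * {ffun 'I_n -> 'I_K})
    (w : {ffun 'I_n -> 'I_K * 'I_l}) : bool :=
  [forall b, (w (x.1 b)).2 == (val b).1] && [forall v, (w v).1 == x.2 v].

Lemma readingP (x : {ffun box la mu -> 'I_n} * {ffun 'I_n -> 'I_K})
    (w : {ffun 'I_n -> 'I_K * 'I_l}) :
  reflect ((forall b, (w (x.1 b)).2 = (val b).1) /\ (forall v, (w v).1 = x.2 v))
    (reading x w).
Proof.
apply: (iffP andP) => -[H1 H2]; split.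
- by move=> b; apply/eqP/(fintype.forallP H1).
- by move=> b; apply/eqP/(fintype.forallP H2).
- by apply/fintype.forallP => b; rewrite H1.
- by apply/fintype.forallP => b; rewrite H2.
Qed.

Lemma shapeE (w : {ffun 'I_n -> 'I_K * 'I_l}) k (i : 'I_l) : word_shape (beta mu) w k i =
  (nth 0%N mu i + row_count (fun v => (w v).2) k i)%N%:Z - i%:Z.
Proof. by rewrite !ffunE PoszD addrAC. Qed.

Lemma SYT_Des_row (T : {ffun box la mu -> 'I_n}) (w : {ffun 'I_n -> 'I_K * 'I_l})
    (i : 'I_n.-1) (v u : 'I_n) :
    is_SYT T -> (forall b, (w (T b)).2 = (val b).1) -> v = i :> nat -> u = i.+1 :> nat ->
  (i \notin SYT_Des T) = ((w u).2 <= (w v).2)%N.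
Proof.
move=> sT wT vi ui; rewrite leqNgt; congr (~~ _); rewrite inE.
have [b bv] := SYT_surj sT v; have [c cu] := SYT_surj sT u.
apply/fintype.existsP/idP => [[b' /fintype.existsP[c' /and3P[/eqP b'i /eqP c'i]]]|lt].
  have -> : v = T b' by apply: val_inj; rewrite /= vi.
  have -> : u = T c' by apply: val_inj; rewrite /= ui.
  by rewrite !wT.
exists b; apply/fintype.existsP; exists c; rewrite bv cu vi ui !eqxx /=.
by rewrite /brow -!wT bv cu.
Qed.

Lemma valid_word_reading T z w : is_SYT T -> compat (SYT_Des T) z -> reading (T, z) w ->
  valid_word (beta mu) (K * l) (beta la) w.
Proof.
move=> sT /compatP cz /readingP[/= wT wz]; apply/and4P; split.
- by apply/fintype.forallP => v; apply: move_rank_lt.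
- apply/fintype.forallP => v; apply/fintype.forallP => u; apply/implyP.
  apply: (ord_chain (@precedes_trans _ _)) => {}v {}u uv.
  have iP : (v < n.-1)%N by have := ltn_ord u; lia.
  have := cz (Ordinal iP) v u erefl uv.
  by rewrite precedesE !wz (SYT_Des_row sT wT (i := Ordinal iP) erefl uv).
- apply/fintype.forallP => k; apply/decreasingP => i j ij; rewrite !shapeE.
  by have := SYT_partial (row := fun v => (w v).2) sT wT (ltnW (ltn_ord k)) ij; lia.
- apply/eqP/ffunP => i; rewrite shapeE (SYT_row_count_size (row := fun v => (w v).2) sT wT).
  by rewrite ffunE.
Qed.

Lemma ex_reading T z : is_SYT T -> exists w, reading (T, z) w.
Proof.
move=> sT; have H v : exists x : 'I_K * 'I_l, x.1 = z v /\ forall b, T b = v -> (val b).1 = x.2.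
  have [b bv] := SYT_fiber sT v; exists (z v, (val b).1); split=> //= c cv.
  by rewrite ((bv c).1 cv).
have [w wP] := fin_all_exists H; exists (finfun w).
by apply/readingP; split=> [b|v] /=; rewrite ffunE; [apply/esym/(wP _).2|exact: (wP v).1].
Qed.

Lemma reading_inj T z w w' : is_SYT T -> reading (T, z) w -> reading (T, z) w' -> w = w'.
Proof.
move=> sT /readingP[/= w1 w2] /readingP[/= w1' w2']; apply/ffunP => v.
have [b bv] := SYT_surj sT v.
by rewrite (surjective_pairing (w v)) (surjective_pairing (w' v)) w2 w2' -bv w1 w1'.
Qed.

(** By [SYT_count], the row of a box and the number of earlier entries in that row determine its
    entry, and the word knows both. *)
Lemma reading_inj2 T z T' z' w : is_SYT T -> is_SYT T' ->
  reading (T, z) w -> reading (T', z') w -> (T, z) = (T', z').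
Proof.
move=> sT sT' /readingP[/= w1 w2] /readingP[/= w1' w2']; congr pair; apply/ffunP => b; last first.
  by rewrite -w2 w2'.
have := SYT_count (row := fun v => (w v).2) sT w1 b.
rewrite {1}(SYT_count (row := fun v => (w v).2) sT' w1' b) => /addnI e.
by apply: (row_count_inj (row := fun v => (w v).2)); rewrite ?w1 ?w1'.
Qed.

(** Step [v] of the word adds one box at the end of row [(w v).2]; that box receives the entry
    [v]. *)
Lemma ex_tableau w : valid_word (beta mu) (K * l) (beta la) w ->
  exists T z, [/\ is_SYT T, compat (SYT_Des T) z & reading (T, z) w].
Proof.
case/and4P => _ /fintype.forallP pw /fintype.forallP dw /eqP sw; pose row v := (w v).2.
have sn (i : 'I_l) : (nth 0%N mu i + row_count row n i)%N = nth 0%N la i.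
  by move/ffunP: sw => /(_ i); rewrite shapeE ffunE -/row; lia.
have sk k (i j : 'I_l) : (k <= n)%N -> (i < j)%N ->
    (nth 0%N mu j + row_count row k j <= nth 0%N mu i + row_count row k i)%N.
  rewrite leq_eqVlt => /predU1P[->|kn] ij.
    (* Validity speaks of the shapes before each letter; the final shape is [la]. *)
    by rewrite !sn; apply: partition_nth skew_la (ltnW ij).
  pose s (i : 'I_l) := (nth 0%N mu i + row_count row k i)%N.
  (* Strict decrease of the shifted lengths gives weak decrease of the lengths for adjacent rows
     only, whence the chain. *)
  apply: (ord_chain (e := fun x y : nat => (y <= x)%N) (w := s) _ _ ij).
    by move=> y x z yx zy; exact: leq_trans zy yx.
  move=> {ij}i {}j ij; have /decreasingP/(_ i j) := dw (Ordinal kn).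
  by rewrite !shapeE /s /= -/row; lia.
have rs v : (nth 0%N mu (row v) + row_count row v (row v) < nth 0%N la (row v))%N.
  have := leq_row_count row (row v) (ltn_ord v).
  by rewrite -sn row_countS eqxx; lia.
have colv v : exists b : box la mu, (val b).1 = row v /\
    bcol b = (nth 0%N mu (row v) + row_count row v (row v))%N.
  by have [|b b1 b2] := @ex_box (row v) (nth 0%N mu (row v) + row_count row v (row v))%N;
    [have := rs v; lia|exists b].
have [f fP] := fin_all_exists colv.
have posb (b : box la mu) : exists v, row v = (val b).1 /\
    bcol b = (nth 0%N mu (val b).1 + row_count row v (val b).1)%N.
  have := boxP b; have := sn (val b).1 => snb bb.
  have [|v v1 v2] := @row_count_onto n l row n (bcol b - nth 0%N mu (val b).1)%N (val b).1 (leqnn n).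
    by lia.
  by exists v; split=> //; lia.
have [g gP] := fin_all_exists posb.
pose T : {ffun box la mu -> 'I_n} := finfun g.
have Trow b : row (T b) = (val b).1 by rewrite ffunE; exact: (gP b).1.
have Tcol b : bcol b = (nth 0%N mu (val b).1 + row_count row (T b) (val b).1)%N.
  by rewrite ffunE; exact: (gP b).2.
have Tinj : injective T.
  by move=> b c bc; apply: box_inj; rewrite ?Tcol -!Trow bc.
have Tf v : T (f v) = v.
  have [f1 f2] := fP v; apply: (row_count_inj (row := row)); rewrite ?Trow ?f1 //.
  by have := Tcol (f v); rewrite f2 f1; lia.
have sT : is_SYT T.
  apply/and3P; split.
  - apply/fintype.forallP => v; apply/card1P; exists (f v) => b.
    by rewrite [RHS]inE -(inj_eq Tinj) Tf -[RHS]boolp.asboolb.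
  - apply/fintype.forallP => b; apply/fintype.forallP => c; apply/implyP => /andP[/eqP/val_inj bc].
    rewrite !Tcol bc ltn_add2l; apply: contraLR; rewrite -!leqNgt.
    exact: leq_row_count.
  - apply/fintype.forallP => b; apply/fintype.forallP => c; apply/implyP => /andP[/eqP bc rbc].
    rewrite ltnNge; apply/negP => le.
    (* If [c] were filled before the box [b] above it, then just after step [T c] the lower row
       would be longer than the upper one. *)
    have := sk (T c).+1 _ _ (ltn_ord (T c)) rbc; rewrite row_countS Trow eqxx.
    have := Tcol c; have := Tcol b.
    have nbc : ((val c).1 == (val b).1) = false by rewrite -val_eqE gtn_eqF.
    rewrite row_countS Trow nbc addn0.
    have := leq_row_count row (val b).1 le; lia.
pose z := [ffun v => (w v).1]; have rT : reading (T, z) w.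
  by apply/readingP; split=> [b|v] /=; [exact: Trow|rewrite ffunE].
exists T, z; split=> //; apply/compatP => i v u vi ui.
have /readingP[/= wT wz] := rT.
have := fintype.forallP (pw v) u; rewrite vi ui ltnSn precedesE !wz.
by rewrite (SYT_Des_row sT wT vi ui).
Qed.

Lemma valid_word_tableaux :
  \sum_(w : {ffun 'I_n -> 'I_K * 'I_l} | valid_word (beta mu) (K * l) (beta la) w)
    \prod_v wt (w v).1 =
  \sum_(T : {ffun box la mu -> 'I_n} | is_SYT T)
    \sum_(z : {ffun 'I_n -> 'I_K} | compat (SYT_Des T) z) \prod_v wt (z v).
Proof.
rewrite pair_big_dep /=; symmetry.
apply: (reindex_rel (S := reading)) => [[T z] /andP[sT cz]|w vw|[T z] w w' /andP[sT _]|
    [T z] [T' z'] w /andP[sT _] /andP[sT' _]|[T z] w _ _ /readingP[_ wz]].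
- have [w rw] := ex_reading z sT; exists w => //; exact: valid_word_reading rw.
- by have [T [z [sT cz rT]]] := ex_tableau vw; exists (T, z); rewrite //= sT.
- exact: reading_inj.
- exact: reading_inj2.
- by apply: eq_bigr => v _; rewrite wz.
Qed.

End Skew.

(** * Truncated power series *)

Section PowerSeries.
Variables (I : choiceType) (R : comNzRingType).
Implicit Types (f g : powser I R) (m : {cmonom I}).

Lemma coefpsM f g m :
  coefps (f * g) m = \sum_(p \in splits m) coefps f p.1 * coefps g p.2.
Proof. by []. Qed.

Lemma coefps1 m : coefps (1 : powser I R) m = (m == mone)%:R.
Proof. by []. Qed.

Lemma mulmI (a : {cmonom I}) : injective (mmul a).
Proof.
move=> x y /(congr1 (fun u : {cmonom I} => u : I -> nat)) e; apply/eqP/cmP => i.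
by move: (congr1 (@^~ i) e); rewrite /= !cmM => /addnI.
Qed.

Lemma coefps_monoM (a : {cmonom I}) (c : R) g f m :
    (forall m', coefps g m' = if m' == a then c else 0) ->
  coefps (g * f) (mmul a m) = c * coefps f m.
Proof.
move=> gE; rewrite coefpsM (fsbigD1 (a, m)) //=; last exact: finite_splits.
rewrite gE eqxx fsbig1 ?addr0 // => -[b x] /= [bx ne].
rewrite gE; case: eqP => [ba|]; last by rewrite mul0r.
by case: ne; move: bx; rewrite /splits /= ba => /mulmI ->.
Qed.

Lemma coefps_constM c f m : coefps (constps I c * f) m = c * coefps f m.
Proof. by rewrite -[m in LHS]mul1m; apply: coefps_monoM. Qed.

Lemma coefps_varM i f m : coefps (varps R i * f) (mmul (ucm i) m) = coefps f m.
Proof. by rewrite (coefps_monoM (c := 1)) ?mul1r // => m' /=; case: eqP. Qed.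

Lemma coefps_varM0 i f m : m i = 0%N -> coefps (varps R i * f) m = 0.
Proof.
move=> mi; rewrite coefpsM fsbig1 // => -[a x] /= ax.
case: eqP => [au|]; last by rewrite mul0r.
by move: mi; rewrite -ax au cmM cmUU.
Qed.

Lemma coefps_sum (J : Type) (r : seq J) (P : pred J) (F : J -> powser I R) m :
  coefps (\sum_(j <- r | P j) F j) m = \sum_(j <- r | P j) coefps (F j) m.
Proof. by elim/big_rec2: _ => // j x y _ <-. Qed.

End PowerSeries.

(** * Series in [u] and their linear factors *)

Section UnivariateSeries.
Variable A : comNzRingType.
Implicit Types (P : powser unit A) (c : A).

Local Notation upow := (expcmn (ucm tt)).
Local Notation lin c := (1 - constps unit c * varps A tt).

Lemma upow_tt n : upow n tt = n.
Proof.
case: n => [|n]; first exact: cm1.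
rewrite /expcmn iteropS; elim: n => [|n IH]; first exact: cmUU.
by rewrite iterS cmM IH cmUU.
Qed.

Lemma upowE (m : {cmonom unit}) : m = upow (m tt).
Proof. by apply/eqP/cmP => -[]; rewrite upow_tt. Qed.

Lemma upow_neq1 n : (upow n.+1 == mone) = false.
Proof. by apply/eqP => e; have := upow_tt n.+1; rewrite e cm1. Qed.

Lemma upowS n : upow n.+1 = mmul (ucm tt) (upow n).
Proof. by apply/eqP/cmP => -[]; rewrite cmM cmUU !upow_tt. Qed.

Lemma coefps_linM0 c P : coefps (lin c * P) (upow 0) = coefps P (upow 0).
Proof.
rewrite mulrBl mul1r -mulrA [LHS](_ : _ = coefps P (upow 0) -
  coefps (constps unit c * (varps A tt * P)) (upow 0)) //.
by rewrite coefps_constM coefps_varM0 ?mulr0 ?subr0 ?upow_tt.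
Qed.

Lemma coefps_linMS c P n :
  coefps (lin c * P) (upow n.+1) = coefps P (upow n.+1) - c * coefps P (upow n).
Proof.
rewrite mulrBl mul1r -mulrA [LHS](_ : _ = coefps P (upow n.+1) -
  coefps (constps unit c * (varps A tt * P)) (upow n.+1)) //.
by rewrite coefps_constM upowS coefps_varM.
Qed.

Lemma lin_unit c : lin c \is a GRing.unit.
Proof.
(* The inverse is the geometric series. *)
pose G : powser unit A := PowSer (fun m => c ^+ m tt).
have Gn n : coefps G (upow n) = c ^+ n by rewrite -[in RHS](upow_tt n).
suff GE : lin c * G = 1 by apply/unitrPr; exists G.
apply: powserP => m; rewrite (upowE m); case: (m tt) => [|n].
  by rewrite coefps_linM0 Gn expr0 /= eqxx.
rewrite coefps_linMS !Gn exprS subrr coefps1 upow_neq1.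
by [].
Qed.

End UnivariateSeries.

Section Truncation.
Variables (C : comNzRingType) (N : nat).
Implicit Types f g : serX C.

Definition supported (m : {cmonom nat}) : Prop := forall i, (N <= i)%N -> m i = 0%N.

(** Equality after setting the variables of index at least [N] to zero. *)
Definition trunc_eq f g : Prop := forall m, supported m -> coefps f m = coefps g m.

Lemma trunc_eqD f f' g g' : trunc_eq f f' -> trunc_eq g g' -> trunc_eq (f + g) (f' + g').
Proof. by move=> ff gg m sm; move: (ff m sm) (gg m sm) => /= -> ->. Qed.

(** Every divisor of a monomial in the first [N] variables is again such a monomial. *)
Lemma trunc_eqM f f' g g' : trunc_eq f f' -> trunc_eq g g' -> trunc_eq (f * g) (f' * g').
Proof.
move=> ff gg m sm; rewrite !coefpsM; apply: eq_fsbigr => -[a b].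
rewrite in_setE /splits /= => ab.
have [sa sb] : supported a /\ supported b.
  by split=> i /sm; rewrite -ab cmM; lia.
by rewrite (ff a sa) (gg b sb).
Qed.

Lemma trunc_eq_sum (J : Type) (r : seq J) (P : pred J) (F G : J -> serX C) :
    (forall j, P j -> trunc_eq (F j) (G j)) ->
  trunc_eq (\sum_(j <- r | P j) F j) (\sum_(j <- r | P j) G j).
Proof. by move=> FG; elim/big_rec2: _ => // j x y Pj; apply: trunc_eqD; apply: FG. Qed.

Lemma trunc_eq_prod (J : Type) (r : seq J) (P : pred J) (F G : J -> serX C) :
    (forall j, P j -> trunc_eq (F j) (G j)) ->
  trunc_eq (\prod_(j <- r | P j) F j) (\prod_(j <- r | P j) G j).
Proof. by move=> FG; elim/big_rec2: _ => // j x y Pj; apply: trunc_eqM; apply: FG. Qed.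

Lemma trunc_eq_det n (M M' : 'M[serX C]_n) :
  (forall i j, trunc_eq (M i j) (M' i j)) -> trunc_eq (\det M) (\det M').
Proof.
move=> MM; apply: trunc_eq_sum => s _; apply: trunc_eqM => //.
exact: trunc_eq_prod.
Qed.

Lemma trunc_eq_var k : (N <= k)%N -> trunc_eq (varps C k) 0.
Proof.
move=> Nk m sm /=; case: eqP => // mk.
by have := sm k Nk; rewrite mk cmUU.
Qed.

End Truncation.

(** * Recursion of the Hall-Littlewood functions in the signed letters *)

Lemma mul_fraction (R : comUnitRingType) (x y z : R) :
  z \is a GRing.unit -> z * (x * (y / z)) = y * x.
Proof. by move=> uz; rewrite mulrCA [z * _]mulrCA divrr // mulr1 mulrC. Qed.

Section HallLittlewoodRecursion.
Variables (C : comNzRingType) (q : C).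

Definition trunc_q (N n : nat) : serX C :=
  coefps (\prod_(i < N) hl_factor (- q) i) (expcmn (ucm tt) n).

(** Clearing the denominator of the new factor gives [(1 - x u) P_{N+1} = (1 + q x u) P_N] with
    [x = varps C N]; then coefficients of powers of [u] are compared. *)
Lemma trunc_q_rec N :
  (forall n, trunc_q N.+1 n.+1 = trunc_q N n.+1 + constps nat q * varps C N * trunc_q N n
     + varps C N * trunc_q N.+1 n) /\ trunc_q N.+1 0 = trunc_q N 0.
Proof.
pose P n := \prod_(i < n) hl_factor (- q) i.
pose lin (c : serX C) : powser unit (serX C) := 1 - constps unit c * varps (serX C) tt.
have PS : lin (varps C N) * P N.+1 = lin (varps C N * constps nat (- q)) * P N.
  rewrite /P big_ord_recr; apply: mul_fraction; exact: lin_unit.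
have cq : varps C N * constps nat (- q) = - (constps nat q * varps C N).
  rewrite mulrC -mulNr; congr (_ * _); apply: powserP => m /=.
  by case: eqP; rewrite ?oppr0.
split=> [n|].
  have := congr1 (fun Q => coefps Q (expcmn (ucm tt) n.+1)) PS.
  rewrite !coefps_linMS cq mulNr opprK => /eqP.
  by rewrite subr_eq => /eqP.
have := congr1 (fun Q => coefps Q (expcmn (ucm tt) 0)) PS.
by rewrite !coefps_linM0.
Qed.

Lemma trunc_q0 n : trunc_q 0 n = (n == 0%N)%:R.
Proof.
by rewrite /trunc_q big_ord0 coefps1; case: n => [|n]; rewrite ?eqxx ?upow_neq1.
Qed.

Lemma trunc_q_stable N M n : (N <= M)%N -> trunc_eq N (trunc_q M n) (trunc_q N n).
Proof.
move=> NM; rewrite -(subnKC NM); elim: (M - N)%N n => [|k IH] n; first by rewrite addn0.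
rewrite addnS; case: n => [|n]; first by rewrite (trunc_q_rec _).2.
have var0 f : trunc_eq N (varps C (N + k) * f) 0.
  by rewrite -[0](mul0r f); apply: trunc_eqM => //; apply: trunc_eq_var; exact: leq_addr.
rewrite (trunc_q_rec _).1 -mulrA -[trunc_q N n.+1]addr0; apply: trunc_eqD => //.
rewrite -[trunc_q N n.+1]addr0; apply: trunc_eqD => //.
by rewrite -[0](mulr0 (constps nat q)); apply: trunc_eqM.
Qed.

(** On monomials in the first [N] variables the partial products are constant from [N] on, so that
    constant is the only possible limit. *)
Lemma hl_q_trunc N n : trunc_eq N (hl_q (- q) n) (trunc_q N n).
Proof.
move=> m sm; rewrite /hl_q /=; apply: xget_unique => /=.
  by exists N => // M /= NM; apply: trunc_q_stable.
move=> c [M _ Mc]; rewrite -(trunc_q_stable n (leq_maxl N M) sm).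
by apply/esym/(Mc (maxn N M)); exact: leq_maxr.
Qed.

Definition trunc_qz N (k : int) : serX C := if k is Posz n then trunc_q N n else 0.

Lemma trunc_qz_rec N k : trunc_qz N.+1 k =
  trunc_qz N k + constps nat q * varps C N * trunc_qz N (k - 1)
  + varps C N * trunc_qz N.+1 (k - 1).
Proof.
case: k => [[|n]|n].
- by rewrite /= (trunc_q_rec _).2 !mulr0 !addr0.
- by rewrite (_ : Posz n.+1 - 1 = n) ?[LHS](trunc_q_rec _).1 //; lia.
- by rewrite (_ : Negz n - 1 = Negz n.+1) /= ?mulr0 ?addr0 //; lia.
Qed.

Definition letter_weight (c : nat) : serX C :=
  constps nat (q ^+ ~~ odd c) * varps C c./2.

(* The letters below c are the signed versions of the first c./2 variables, and for odd c
   also the negative version of the next one. *)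
Definition letter_q (c : nat) (k : int) : serX C :=
  trunc_qz c./2 k +
  (if odd c then letter_weight c.-1 * trunc_qz c./2 (k - 1) else 0).

Lemma letter_q0 k : letter_q 0 k = (k == 0)%:R.
Proof. by rewrite /letter_q addr0; case: k => [n|n] //=; rewrite trunc_q0. Qed.

Lemma letter_q_neg c k : k < 0 -> letter_q c k = 0.
Proof.
move=> k0; have tz N k' : k' < 0 -> trunc_qz N k' = 0 by case: k'.
by rewrite /letter_q !tz ?mulr0 ?if_same ?addr0 //; lia.
Qed.

Lemma letter_weight_even N : letter_weight N.*2 = constps nat q * varps C N.
Proof. by rewrite /letter_weight odd_double expr1 doubleK. Qed.

Lemma letter_weight_odd N : letter_weight N.*2.+1 = varps C N.
Proof.
rewrite /letter_weight oddS odd_double expr0 -[_./2]/(uphalf _) uphalf_double.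
by rewrite (_ : constps nat 1 = 1) ?mul1r //; apply: powserP => m /=; case: eqP.
Qed.

Lemma letter_q_even N k : letter_q N.*2 k = trunc_qz N k.
Proof. by rewrite /letter_q odd_double doubleK addr0. Qed.

Lemma letter_q_odd N k : letter_q N.*2.+1 k =
  trunc_qz N k + constps nat q * varps C N * trunc_qz N (k - 1).
Proof.
by rewrite /letter_q oddS odd_double -[_./2]/(uphalf _) uphalf_double letter_weight_even.
Qed.

(** This is hypothesis [HS] of the row recursion. A negative letter contributes the polynomial
    factor [1 + q x u], a positive one the denominator [1 - x u]; the latter puts the new bound on
    the right-hand side. *)
Lemma letter_q_rec c k :
  letter_q c.+1 k = letter_q c k + letter_weight c * letter_q (c + odd c) (k - 1).
Proof.
have [N [->|->]] : exists N, c = N.*2 \/ c = N.*2.+1.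
- by exists c./2; have := odd_double_half c; case: odd; [right|left].
- by rewrite odd_double addn0 letter_q_odd !letter_q_even letter_weight_even.
rewrite oddS odd_double addn1 -doubleS !letter_q_even letter_q_odd letter_weight_odd.
exact: trunc_qz_rec.
Qed.

End HallLittlewoodRecursion.

(** * Fundamental quasisymmetric series *)

(** The order isomorphism sending [0, 1, 2, 3, ...] to -1, 1, -2, 2, and so on. *)
Definition spos_of (c : nat) : spos := (c./2, odd c).

Definition nat_of_spos (x : spos) : nat := (x.2 + x.1.*2)%N.

Lemma spos_ofK : cancel spos_of nat_of_spos.
Proof. by move=> c; rewrite /nat_of_spos odd_double_half. Qed.

Lemma nat_of_sposK : cancel nat_of_spos spos_of.
Proof.
case=> k b; rewrite /spos_of /nat_of_spos /= half_bit_double oddD odd_double addbF.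
by case: b.
Qed.

Lemma spos_of_lt c d : (spos_of c < spos_of d)%O = (c < d)%N.
Proof.
rewrite /spos_of ltxi_pair !leEnat ltEbool.
rewrite -[in RHS](odd_double_half c) -[in RHS](odd_double_half d).
by case: (odd c); case: (odd d); lia.
Qed.

Section Descents.
Variable n : nat.
Implicit Types (pi : {perm 'I_n}) (I : {set 'I_n.-1}).

Lemma perm_DesE pi (i : 'I_n.-1) (v u : 'I_n) : v = i :> nat -> u = i.+1 :> nat ->
  (i \in perm_Des pi) = (pi u < pi v)%N.
Proof.
move=> vi ui; rewrite inE; apply/fintype.existsP/idP => [[a /fintype.existsP[b /and3P[/eqP ai /eqP bi]]]|lt].
  have -> : v = a by apply: val_inj; rewrite /= vi.
  by have -> : u = b by apply: val_inj; rewrite /= ui.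
by exists v; apply/fintype.existsP; exists u; rewrite vi ui !eqxx.
Qed.

(** Cut the positions after each element of [I] into blocks. Values increase inside a block, and
    each block takes smaller values than the block before it; [prec] is this order of values and
    [rk] the resulting rank. *)
Lemma ex_perm_Des I : exists pi, perm_Des pi = I.
Proof.
pose blk (v : nat) := #|[set i : 'I_n.-1 in I | (i < v)%N]|.
have blk_le v u : (v <= u)%N -> (blk v <= blk u)%N.
  move=> vu; apply/subset_leq_card/fintype.subsetP => i; rewrite !inE => /andP[-> iv].
  exact: leq_trans iv vu.
pose prec (u v : 'I_n) := (blk v < blk u)%N || (blk v == blk u) && (u < v)%N.
have prec_trans : transitive prec by move=> y x z; rewrite /prec; lia.
pose rk v := #|[set u | prec u v]|.
have rk_lt u v : prec u v -> (rk u < rk v)%N.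
  move=> uv; apply/proper_card/fintype.properP; split.
    by apply/fintype.subsetP => x; rewrite !inE => /prec_trans; apply.
  by exists u; rewrite !inE // /prec ltnn ltnn andbF.
have rk_n v : (rk v < n)%N.
  have : (rk v < #|'I_n|)%N; last by rewrite card_ord.
  rewrite -cardsT; apply/proper_card/fintype.properP; split; first exact: finset.subsetT.
  by exists v; rewrite !inE // /prec ltnn ltnn andbF.
have rk_inj : injective (fun v => Ordinal (rk_n v)).
  move=> u v [] e; apply/eqP; apply: contra_eqT e => uv.
  have [/rk_lt|/rk_lt] : prec u v \/ prec v u; try by move=> lt; lia.
  by move: uv; rewrite /prec -val_eqE /=; lia.
exists (perm rk_inj); apply/setP => i.
have vP : (i < n)%N by have := ltn_ord i; lia.
have uP : (i.+1 < n)%N by have := ltn_ord i; lia.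
rewrite (@perm_DesE _ i (Ordinal vP) (Ordinal uP)) // !permE /=.
have blkS : blk i.+1 = (blk i + (i \in I))%N.
  case: (boolP (i \in I)) => iI.
    rewrite addn1 /blk (_ : [set _ in I | _] = i |: [set j : 'I_n.-1 in I | (j < i)%N])%SET.
      by rewrite cardsU1 !inE ltnn andbF.
    apply/setP => j; rewrite !inE ltnS leq_eqVlt -(val_eqE j i) /=.
    by case: (eqVneq (j : nat) i) => [/val_inj ->|_] //=; rewrite iI.
  rewrite addn0; apply: eq_card => j; rewrite !inE ltnS leq_eqVlt.
  by case: (eqVneq (j : nat) i) => [/val_inj ->|_] //=; rewrite (negPf iI).
case: (boolP (i \in I)) blkS => iI blkS.
  by apply: rk_lt; rewrite /prec /= blkS; lia.
apply/negbTE; rewrite -leqNgt ltnW //; apply: rk_lt; rewrite /prec /= blkS; lia.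
Qed.

End Descents.

Lemma reindex_prod_perm (R : comNzRingType) n (pi : {perm 'I_n}) (F G : 'I_n -> R) :
  (forall v, F (pi v) = G v) -> \prod_i F i = \prod_i G i.
Proof.
by move=> FG; rewrite (reindex_inj (@perm_inj _ pi)); apply: eq_bigr => v _; exact: FG.
Qed.

Lemma fsbig_fin (V : nmodType) (T : finType) (P : pred T) (F : T -> V) :
  \sum_(z \in [set z | P z]%classic) F z = \sum_(z | P z) F z.
Proof.
have -> : [set z | P z]%classic = [set` [seq z <- index_enum T | P z]]%classic.
  by apply/seteqP; split=> z; rewrite /= mem_filter mem_index_enum andbT.
by rewrite -fsbig_seq ?filter_uniq ?index_enum_uniq // big_filter.
Qed.

Section FundamentalSeries.
Variables (C : comNzRingType) (q : C) (n N : nat).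

(** [z] is indexed by positions in [pi], enriched partitions by the elements at those positions. *)
Definition order_code (pi : {perm 'I_n}) (z : {ffun 'I_n -> 'I_(N.*2)}) : {ffun 'I_n -> spos} :=
  [ffun a => spos_of (z ((pi^-1)%g a))].

Lemma enriched_compat (pi : {perm 'I_n}) (z : {ffun 'I_n -> 'I_(N.*2)}) :
  enriched (perm_lt pi) (order_code pi z) <-> compat (perm_Des pi) z.
Proof.
(* On a run of equal letters [pi] is increasing if the letter is positive and decreasing if it is
   negative. Hence [e] is transitive, and consecutive positions suffice. *)
pose e (v u : 'I_n) := (z v < z u)%N || (z v == z u) && (odd (z v) == (pi v < pi u)%N).
have e_trans : transitive e.
  by move=> y x w; rewrite /e -!val_eqE /=; case: eqVneq => [->|]; case: eqVneq => [->|]; lia.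
have pi_ne (v u : 'I_n) : v != u -> val (pi v) != val (pi u).
  by rewrite val_eqE (inj_eq perm_inj).
split.
  move=> en; apply/compatP => i v u vi ui.
  rewrite (perm_DesE pi vi ui) -leqNgt.
  have vu : (v < u)%N by lia.
  have := en (pi v) (pi u); rewrite /perm_lt !permK => /(_ vu).
  rewrite !ffunE !permK !spos_of_lt /isneg negbK /=.
  have ne : val (pi v) != val (pi u) by apply: pi_ne; rewrite -val_eqE (ltn_eqF vu).
  case: (ltngtP (pi v) (pi u)) => [_|_|e']; last (by case/eqP: ne); move=> [H1 H2].
    by case: (H1 isT) => [->|[/(can_inj spos_ofK)/val_inj -> ->]]; rewrite ?eqxx ?orbT.
  by case: (H2 isT) => [->|[/(can_inj spos_ofK)/val_inj -> /negPf ->]]; rewrite ?eqxx ?orbT.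
move=> /compatP cz i j.
rewrite /perm_lt; set v := (pi^-1)%g i; set u := (pi^-1)%g j => vu.
have : e v u.
  apply: (ord_chain (w := id) e_trans) vu => {}v {}u uv.
  have iP : (v < n.-1)%N by have := ltn_ord u; lia.
  have := cz (Ordinal iP) v u erefl uv.
  rewrite (@perm_DesE _ pi (Ordinal iP) v u) // -leqNgt /e.
  have vu : v != u by rewrite -val_eqE /= uv; lia.
  by rewrite [(_ <= pi u)%N]leq_eqVlt (negPf (pi_ne _ _ vu)).
rewrite /e !ffunE -/v -/u !spos_of_lt /isneg negbK !permKV /=.
case/orP => [->|/andP[/eqP -> /eqP ->]]; first by split; left.
by split=> lt; right; split=> //; rewrite // -leqNgt ltnW.
Qed.

Lemma letter_weightE c :
  letter_weight q c = constps nat (q ^+ isneg (spos_of c)) * varps C (spos_of c).1.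
Proof. by []. Qed.

(** An enriched map using only the first [N] variables is [order_code pi z] for a unique [z]; any
    other has a factor of index at least [N] in its weight and contributes nothing. *)
Lemma Lq_perm_trunc (pi : {perm 'I_n}) : trunc_eq N (Lq_perm q pi)
  (\sum_(z : {ffun 'I_n -> 'I_(N.*2)} | compat (perm_Des pi) z)
     \prod_v letter_weight q (z v)).
Proof.
move=> m sm; rewrite coefps_sum /=.
pose wt (f : {ffun 'I_n -> spos}) : serX C :=
  \prod_i (constps nat (q ^+ isneg (f i)) * varps C (f i).1).
have code_inj : injective (order_code pi).
  move=> z z' /ffunP e; apply/ffunP => v; have := e (pi v).
  by rewrite !ffunE permK => /(can_inj spos_ofK)/val_inj.
have wt_code z : wt (order_code pi z) = \prod_v letter_weight q (z v).
  apply: (reindex_prod_perm (pi := pi)) => v; rewrite letter_weightE.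
  have -> : order_code pi z (pi v) = spos_of (z v) by rewrite ffunE permK.
  by [].
transitivity (\sum_(f \in [set order_code pi z | z in [set z | compat (perm_Des pi) z]]%classic)
    coefps (wt f) m).
  symmetry; apply: fsbig_widen => [_ /= [z cz <-]|f /= [en nf]]; first exact/enriched_compat.
  have [/fintype.forallP small|] := boolP [forall a, ((f a).1 < N)%N].
    have code_lt v : (nat_of_spos (f (pi v)) < N.*2)%N.
      by rewrite /nat_of_spos; have := small (pi v); case: (f (pi v)).2; lia.
    case: nf; pose z := [ffun v => Ordinal (code_lt v)].
    have ez : order_code pi z = f.
      by apply/ffunP => a; rewrite !ffunE /= permKV nat_of_sposK.
    by exists z => //=; apply/enriched_compat; rewrite ez.
  rewrite negb_forall => /fintype.existsP[a]; rewrite -leqNgt => Na.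
  suff : trunc_eq N (wt f) 0 by move/(_ m sm).
  rewrite -[0](mul0r (\prod_(i | i != a) (constps nat (q ^+ isneg (f i)) * varps C (f i).1))).
  rewrite /wt (bigD1 a) //=; apply: trunc_eqM => //.
  rewrite -[0](mulr0 (constps nat (q ^+ isneg (f a)))); apply: trunc_eqM => //.
  exact: trunc_eq_var.
rewrite fsbig_image; last by move=> z z' _ _; exact: code_inj.
by rewrite fsbig_fin; apply: eq_bigr => z _; rewrite wt_code.
Qed.

Lemma Lq_trunc (I : {set 'I_n.-1}) : trunc_eq N (Lq q I)
  (\sum_(z : {ffun 'I_n -> 'I_(N.*2)} | compat I z) \prod_v letter_weight q (z v)).
Proof.
rewrite /Lq; case: pickP => [pi /eqP <-|none]; first exact: Lq_perm_trunc.
by have [pi piI] := ex_perm_Des I; have := none pi; rewrite piI eqxx.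
Qed.

End FundamentalSeries.

(** Both sides are compared at one monomial, where they may be replaced by finite sums over the
    [N.*2] signed letters. *)
Lemma hl_S_tableaux (C : comNzRingType) (q : C) (la mu : seq nat) :
  is_skew_shape la mu ->
  hl_S la mu (- q) =
    \sum_(T : {ffun box la mu -> 'I_(sumn la - sumn mu)} | is_SYT T) Lq q (SYT_Des T).
Proof.
move=> skew; apply: powserP => m.
have [N sm] : exists N, supported N m.
  (* One more than the largest index occurring in [m]. *)
  exists (\max_(i <- finsupp m) i).+1 => i; rewrite ltnNge => Ni.
  apply/eqP; rewrite cmE_eq0; apply: contra Ni => im.
  by rewrite (big_fsetD1 i im) leq_maxl.
have tLq : trunc_eq N
    (\sum_(T : {ffun box la mu -> 'I_(sumn la - sumn mu)} | is_SYT T) Lq q (SYT_Des T))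
    (\sum_(T : {ffun box la mu -> 'I_(sumn la - sumn mu)} | is_SYT T)
      \sum_(z : {ffun 'I_(sumn la - sumn mu) -> 'I_(N.*2)} | compat (SYT_Des T) z)
        \prod_v letter_weight q (z v)).
  by apply: trunc_eq_sum => T _; exact: Lq_trunc.
rewrite (tLq m sm).
have part_sum (s : seq nat) : (size s <= size la)%N ->
    \sum_i beta la s i = (sumn s)%:Z - \sum_(i < size la) i%:Z.
  move=> sla; under eq_bigr do rewrite ffunE.
  rewrite big_split /= sumrN; congr (_ - _).
  rewrite -(big_mkord xpredT (fun i => (nth 0%N s i)%:Z)) (big_cat_nat (n := size s)) //=.
  rewrite [X in _ + X]big_nat [X in _ + X]big1 ?addr0 => [|i /andP[si _]]; last first.
    by rewrite nth_default.
  by rewrite sumnE [in RHS](big_nth 0%N) (big_morph Posz PoszD erefl).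
have decr s : is_partition s -> decreasing (beta la s).
  move=> ps; apply/decreasingP => i j ij; rewrite !ffunE.
  by have := partition_nth ps (ltnW ij); lia.
have size_mu : (size mu <= size la)%N by case/and4P: skew.
have weight_eq : \sum_i beta la la i = \sum_i beta la mu i + (sumn la - sumn mu)%N%:Z.
  (* This makes the natural-number subtraction [sumn la - sumn mu] an exact one. *)
  have : \sum_i beta la mu i <= \sum_i beta la la i.
    by apply: ler_sum => i _; rewrite !ffunE lerD2r lez_nat skew_leq.
  by rewrite !part_sum //; lia.
rewrite -(valid_word_tableaux skew) -(mixed_det_words (letter_q0 q) (@letter_q_neg _ q)
  (letter_q_rec q) (decr _ (skew_mu skew)) (decr _ (skew_la skew)) weight_eq (leqnn _)).
have tS : trunc_eq N (hl_S la mu (- q))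
    (mixed_det (letter_q q) (beta la mu) (N.*2 * size la) (beta la la)); last exact: tS.
(* After [N.*2] complete sweeps every row has the bound [N.*2], so the entries are the truncated
   [q_n] themselves. *)
apply: trunc_eq_det => i j; rewrite !mxE -[(_ * size la)%N]addn0 alphE // ltn0 addn0.
rewrite letter_q_even !ffunE.
set k := (X in hl_qz _ X); have -> : (nth 0%N la i)%:Z - i%:Z - ((nth 0%N mu j)%:Z - j%:Z) = k.
  by rewrite /k; lia.
by case: k => [k|k] //; exact: hl_q_trunc.
Qed.

Local Open Scope complex_scope.

Theorem theorem2 (R : realType) (q : R[i]) (la mu : seq nat) :
  is_skew_shape la mu ->
  hl_S la mu (- q) =
    \sum_(T : {ffun box la mu -> 'I_(sumn la - sumn mu)} | is_SYT T) Lq q (SYT_Des T).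
Proof. exact: hl_S_tableaux. Qed.
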